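(* Let $\Lambda\subset\mathbb{R}^d$ be a lattice or a finite-dimensional vector subspace over a subfield of $\mathbb{R}$, let $(G,\preceq)$ be a partially ordered abelian group, and let $\varphi:\mathcal{P}(\Lambda)\to G$ be a $\Lambda$-valuation. The following are equivalent: (i) $\varphi$ is combinatorially positive; (ii) $f^\varphi_i$ is combinatorially positive for all $i=0,\dots,d$.
   Context: A $\Lambda$-polytope is a convex polytope with vertices in $\Lambda$; $\mathcal{P}(\Lambda)$ is the set of them (including $\emptyset$). A $\Lambda$-valuation is a map $\psi:\mathcal{P}(\Lambda)\to G$ with $\psi(\emptyset)=0$, $\psi(P\cup Q)+\psi(P\cap Q)=\psi(P)+\psi(Q)$ whenever $P,Q,P\cup Q,P\cap Q\in\mathcal{P}(\Lambda)$, and $\psi(t+P)=\psi(P)$ for $t\in\Lambda$. Partially ordered abelian group: $a\preceq b\Rightarrow a+c\preceq b+c$. For an $r$-dimensional $\Lambda$-polytope $P$ there are unique $h_0,\dots,h_r\in G$ with $\psi(nP)=\sum_{i=0}^rh_i\binom{n+r-i}{r}$ for all $n\in\mathbb{Z}_{\ge0}$; $h^\psi_i(P)=h_i$ for $i\le r$, $0$ for $r<i\le d$, $h^\psi(\emptyset)=0$. $\psi$ is combinatorially positive if $h^\psi_i(P)\succeq0$ for all $P\in\mathcal{P}(\Lambda)$ and $0\le i\le d$. The $f^*$-vector of $\varphi$ consists of the $\Lambda$-valuations $f^\varphi_i(P):=\sum_{k=0}^i\binom{i}{k}(-1)^{i-k}\varphi((k+1)P)$, $i=0,\dots,d$; equivalently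 $\varphi(nP)=\sum_{i=0}^df^\varphi_i(P)\binom{n-1}{i}$ for all $n\ge0$. *)

(* Defs.v *)
From HB Require Import structures.
From mathcomp Require Import all_boot all_order all_algebra.
From mathcomp Require Import all_classical all_reals all_analysis.

Set Implicit Arguments.
Unset Strict Implicit.
Unset Printing Implicit Defensive.

Import Order.TTheory GRing.Theory Num.Theory.
Local Open Scope classical_set_scope.
Local Open Scope ring_scope.

(* The ambient space R^d is 'rV[R]_d for R : realType. *)

Section Lambda.
Variables (R : realType) (d : nat).

(* Linear combinations of the k rows of B with coefficients in S. *)
Definition span_over (S : {pred R}) k (B : 'M[R]_(k, d)) : set 'rV[R]_d :=
  [set v | exists2 c : 'rV[R]_k, c \is a mxOver S & v = c *m B].

(* Full rank is not required. *)
Definition is_lattice (L : set 'rV[R]_d) : Prop :=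
  exists k (B : 'M[R]_(k, d)), row_free B /\ L = span_over Num.int B.

Definition is_subfield_subspace (L : set 'rV[R]_d) : Prop :=
  exists2 F : {pred R}, GRing.divring_closed F &
    exists k (B : 'M[R]_(k, d)), L = span_over F B.

End Lambda.

Section Polytopes.
Variables (R : realType) (d : nat).
Implicit Types (A P : set 'rV[R]_d).

Definition convex_hull A : set 'rV[R]_d :=
  smallest (@convex_set R 'rV[R]_d) A.

Definition is_polytope P : Prop :=
  exists2 A : set 'rV[R]_d, finite_set A & P = convex_hull A.

(* Vertices are the extreme points. *)
Definition vertices P : set 'rV[R]_d :=
  [set v | P v /\ forall x y (t : R), P x -> P y -> 0 < t < 1 ->
     v = t *: x + (1 - t) *: y -> x = v /\ y = v].

(* This includes the empty polytope. *)
Definition lambda_polytope (L P : set 'rV[R]_d) : Prop :=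
  is_polytope P /\ vertices P `<=` L.

Definition translate (t : 'rV[R]_d) P : set 'rV[R]_d := [set t + x | x in P].

Definition dilate (n : nat) P : set 'rV[R]_d := [set n%:R *: x | x in P].

(* P contains k + 1 affinely independent points p0, p0 + b_1, ..., p0 + b_k. *)
Definition has_affinely_independent P (k : nat) : Prop :=
  exists (p0 : 'rV[R]_d) (B : 'M[R]_(k, d)),
    [/\ row_free B, P p0 & forall i, P (p0 + row i B)].

(* The dimension of a nonempty P; the value at set0 is junk (0). *)
Definition polytope_dim P : nat :=
  \max_(k < d.+1 | `[< has_affinely_independent P k >]) k.

End Polytopes.

Section Valuations.
Variables (R : realType) (d : nat) (G : porderZmodType).

Definition order_compatible : Prop :=
  forall a b c : G, a <= b -> a + c <= b + c.

(* A map P(Lambda) -> G is represented by a function on all subsets of R^d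
   whose values off P(Lambda) are irrelevant. *)
Implicit Types psi phi : set 'rV[R]_d -> G.

Definition lambda_valuation (L : set 'rV[R]_d) psi : Prop :=
  [/\ psi set0 = 0,
      forall P Q, lambda_polytope L P -> lambda_polytope L Q ->
        lambda_polytope L (P `|` Q) -> lambda_polytope L (P `&` Q) ->
        psi (P `|` Q) + psi (P `&` Q) = psi P + psi Q
    & forall t P, L t -> lambda_polytope L P -> psi (translate t P) = psi P].

(* [hstar_vector psi P h]: the coefficients h^psi_i(P) are the h i.  Such an h
   exists for every Lambda-valuation psi and Lambda-polytope P (McMullen), and
   it is unique by hstar_vector_unique below. *)
Definition hstar_vector psi (P : set 'rV[R]_d) (h : nat -> G) : Prop :=
  (P = set0 -> forall i, h i = 0) /\
  (P !=set0 ->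
     let r := polytope_dim P in
     (forall n : nat,
        psi (dilate n P) = \sum_(i < r.+1) h i *+ 'C(n + r - i, r)) /\
     (forall i, (r < i)%N -> h i = 0)).

Lemma hstar_vector_unique psi P (h1 h2 : nat -> G) :
  hstar_vector psi P h1 -> hstar_vector psi P h2 -> forall i, h1 i = h2 i.
Proof.
move=> [e1 n1] [e2 n2]; have [P0|PN0] := pselect (P = set0).
  by move=> i; rewrite e1 // e2.
have {PN0} P0 : P !=set0 by apply/set0P/eqP.
have [s1 z1] := n1 P0; have [s2 z2] := n2 P0.
set r := polytope_dim P in s1 z1 s2 z2.
move=> i; elim/ltn_ind: i => i IH; have [ri|ir] := ltnP r i; first by rewrite z1 // z2.
have ir1 : (i < r.+1)%N by [].
have := s1 i; rewrite s2 (bigD1 (Ordinal ir1)) //=.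
rewrite [X in _ = X](bigD1 (Ordinal ir1)) //= addKn binn !mulr1n.
rewrite (eq_bigr (fun j : 'I_r.+1 => h1 j *+ 'C(i + r - j, r))); last first.
  move=> j; rewrite -val_eqE /= neq_ltn => /orP[ji|ij]; first by rewrite IH.
  rewrite bin_small ?mulr0n //.
  have jr := ltn_ord j; rewrite ltnS in jr.
  by rewrite ltn_subLR ?ltn_add2r // (leq_trans jr) // leq_addl.
by move/addIr.
Qed.

(* h^psi_i(P) denotes the unique such coefficient, hence "exists h". *)
Definition combinatorially_positive (L : set 'rV[R]_d) psi : Prop :=
  forall P, lambda_polytope L P ->
    exists2 h, hstar_vector psi P h & forall i, (i <= d)%N -> 0 <= h i.

Definition fstar phi (i : nat) : set 'rV[R]_d -> G :=
  fun P => \sum_(k < i.+1)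
    phi (dilate k.+1 P) *~ ((-1) ^+ (i - k) * 'C(i, k)%:Z).

End Valuations.

(* Main.v *)
(* [fstar phi 0 = phi] gives one direction.  For the other, the h*-expansion of
   [phi] at a single polytope [P] of dimension [r] suffices: by linearity one
   needs that each [C(mn+r-i, r)] with [i <= r] is a nonnegative combination of
   the products [C(m-1, j) C(n+r-l, r)].  Up to the factor [r!] this follows by
   induction on [r], multiplying by [mn+r+1-i] or by [mn-i].  Either factor
   produces negative terms in general; they cancel because only pairs [(j, l)]
   with [(j+1) l >= i] and [(j+1)(r+1-l) >= r+1-i] occur.  The factor [r!] is
   removed afterwards, as the [C(n+r-l, r)] form a unitriangular system. *)
Require Import Defs.
From mathcomp Require Import all_boot all_order all_algebra.
From mathcomp Require Import all_classical all_reals all_analysis.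
From mathcomp Require Import zify ring.
Import Order.TTheory GRing.Theory Num.Theory.
Local Open Scope classical_set_scope.
Local Open Scope ring_scope.

Section BinomialExpansion.
Local Open Scope nat_scope.

(* A pair [(j, l)] stands for the product [C(M, j) C(n+r-l, r)], where [M] is
   [m-1]; a sequence of pairs stands for a sum with multiplicities. *)
Definition pair_term (r M n : nat) (t : nat * nat) : nat :=
  'C(M, t.1) * 'C(n + r - t.2, r).

Definition admissible (r i : nat) (t : nat * nat) : bool :=
  [&& t.2 <= r, i <= t.1.+1 * t.2 & r.+1 <= t.1.+1 * (r.+1 - t.2) + i].

Definition raise_keep (r i : nat) (t : nat * nat) : seq (nat * nat) :=
  let: (j, l) := t in
  nseq (j.+1 * l) (j.+1, l) ++ nseq (j.+1 * l + (r.+1 - i)) (j, l) ++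
  nseq (j.+1 * (r.+1 - l)) (j.+1, l.+1) ++
  nseq (j.+1 * (r.+1 - l) - (r.+1 - i)) (j, l.+1).

Definition raise_shift (r i : nat) (t : nat * nat) : seq (nat * nat) :=
  let: (j, l) := t in
  nseq (j.+1 * l) (j.+1, l) ++ nseq (j.+1 * l - i) (j, l) ++
  nseq (j.+1 * (r.+1 - l)) (j.+1, l.+1) ++
  nseq (j.+1 * (r.+1 - l) + i) (j, l.+1).

Lemma sum_nseq (F : nat * nat -> nat) k t :
  \sum_(u <- nseq k t) F u = k * F t.
Proof. by rewrite big_nseq iter_addn_0 mulnC. Qed.

Lemma bin_mul_arg (r n l : nat) : l <= r ->
  n * 'C(n + r - l, r) = l * 'C(n + r - l, r) + r.+1 * 'C(n + r - l, r.+1).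
Proof.
move=> lr; rewrite mul_bin_left.
have [nl|ln] := ltnP n l; first by rewrite bin_small ?muln0 //; lia.
by rewrite -mulnDl; congr (_ * _); lia.
Qed.

Lemma raise_keep_sum (r i M n : nat) (t : nat * nat) : admissible r i t ->
  i <= r ->
  \sum_(u <- raise_keep r i t) pair_term r.+1 M n u
    = (M.+1 * n + (r.+1 - i)) * pair_term r M n t.
Proof.
case: t => j l /and3P[/= lr _ sup] ir.
rewrite !big_cat /= !sum_nseq /pair_term /=.
have E1 : n + r.+1 - l = (n + r - l).+1 by lia.
have E2 : n + r.+1 - l.+1 = n + r - l by lia.
rewrite E1 E2 binS.
have EX := bin_mul_arg _ n _ lr.
have EM := mul_bin_diag M.+1 j; rewrite /= binS in EM.
move: EX EM; set X := 'C(n + r - l, r); set Z := 'C(n + r - l, r.+1).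
set c := 'C(M, j); set c' := 'C(M, j.+1) => EX EM.
have [f Ef] : exists f, j.+1 * (r.+1 - l) = (r.+1 - i) + f.
  by exists (j.+1 * (r.+1 - l) - (r.+1 - i)); lia.
have EK : r.+1 = l + (r.+1 - l) by lia.
rewrite Ef addKn.
have -> : (M.+1 * n + (r.+1 - i)) * (c * X)
    = (M.+1 * c) * (n * X) + (r.+1 - i) * (c * X) by ring.
rewrite EM EX {3}EK.
set k := r.+1 - l in Ef *; set e := r.+1 - i in Ef *.
have -> : j.+1 * (c' + c) * (l * X + (l + k) * Z) =
  j.+1 * (c' + c) * (l * X + l * Z) + (c' + c) * Z * (j.+1 * k) by ring.
by rewrite Ef; ring.
Qed.

Lemma raise_shift_sum (r i M n : nat) (t : nat * nat) : admissible r i t ->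
  \sum_(u <- raise_shift r i t) pair_term r.+1 M n u + i * pair_term r M n t
    = M.+1 * n * pair_term r M n t.
Proof.
case: t => j l /and3P[/= lr sup _].
rewrite !big_cat /= !sum_nseq /pair_term /=.
have E1 : n + r.+1 - l = (n + r - l).+1 by lia.
have E2 : n + r.+1 - l.+1 = n + r - l by lia.
rewrite E1 E2 binS.
have EX := bin_mul_arg _ n _ lr.
have EM := mul_bin_diag M.+1 j; rewrite /= binS in EM.
move: EX EM; set X := 'C(n + r - l, r); set Z := 'C(n + r - l, r.+1).
set c := 'C(M, j); set c' := 'C(M, j.+1) => EX EM.
have [f Ef] : exists f, j.+1 * l = i + f by exists (j.+1 * l - i); lia.
have EK : r.+1 = l + (r.+1 - l) by lia.
have -> : M.+1 * n * (c * X) = (M.+1 * c) * (n * X) by ring.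
rewrite EM EX {3}EK; set k := r.+1 - l.
have -> : j.+1 * (c' + c) * (l * X + (l + k) * Z) =
  (c' + c) * (X + Z) * (j.+1 * l) + j.+1 * (c' + c) * k * Z by ring.
by rewrite Ef addKn; ring.
Qed.

Lemma raise_keep_admissible (r i : nat) (t : nat * nat) : admissible r i t ->
  i <= r -> all (admissible r.+1 i) (raise_keep r i t).
Proof.
case: t => j l /and3P[/= lr s1 s2] ir.
by rewrite !all_cat !all_nseq /admissible /=; nia.
Qed.

Lemma raise_shift_admissible (r i : nat) (t : nat * nat) : admissible r i t ->
  all (admissible r.+1 i.+1) (raise_shift r i t).
Proof.
case: t => j l /and3P[/= lr s1 s2].
by rewrite !all_cat !all_nseq /admissible /=; nia.
Qed.

Lemma bin_mul_expansion (r i : nat) : i <= r ->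
  exists2 s, all (admissible r i) s & forall M n,
    r`! * 'C(M.+1 * n + r - i, r) = \sum_(t <- s) pair_term r M n t.
Proof.
elim: r i => [|r IH] i.
  rewrite leqn0 => /eqP ->; exists [:: (0, 0)] => // M n.
  by rewrite big_seq1 /pair_term !bin0.
rewrite leq_eqVlt => /orP[/eqP ->|]; last rewrite ltnS => ir.
  have [s /allP sA sE] := IH r (leqnn r).
  exists (flatten [seq raise_shift r r t | t <- s]).
    apply/allP => u /flatten_mapP[t /sA /raise_shift_admissible/allP]; exact.
  move=> M n; rewrite big_flatten big_map.
  apply: (@addIn (r * \sum_(t <- s) pair_term r M n t)).
  have -> : \sum_(t <- s) \sum_(u <- raise_shift r r t) pair_term r.+1 M n u
      + r * \sum_(t <- s) pair_term r M n t
      = M.+1 * n * \sum_(t <- s) pair_term r M n t.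
    rewrite !big_distrr -big_split /=; apply: eq_big_seq => t /sA.
    exact: raise_shift_sum.
  rewrite -sE !addnK.
  have E := mul_bin_left (M.+1 * n) r.
  have [lt|ge] := ltnP (M.+1 * n) r; first by rewrite !bin_small ?muln0 //; lia.
  rewrite factS; have -> : r.+1 * r`! * 'C(M.+1 * n, r.+1) =
    r`! * (r.+1 * 'C(M.+1 * n, r.+1)) by ring.
  rewrite E; move: ge; set N := M.+1 * n; set X := (X in _ * (_ * X)) => ge.
  have -> : N * (r`! * X) = r`! * X * (N - r + r) by rewrite subnK // mulnC.
  by ring.
have [s /allP sA sE] := IH i ir.
exists (flatten [seq raise_keep r i t | t <- s]).
  apply/allP => u /flatten_mapP[t /sA H].
  by have /allP := raise_keep_admissible _ _ _ H ir; apply.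
move=> M n; rewrite big_flatten big_map.
have -> : \sum_(t <- s) \sum_(u <- raise_keep r i t) pair_term r.+1 M n u
    = (M.+1 * n + (r.+1 - i)) * \sum_(t <- s) pair_term r M n t.
  rewrite big_distrr /=; apply: eq_big_seq => t /sA tA.
  exact: raise_keep_sum.
rewrite -sE.
have -> : M.+1 * n + r.+1 - i = (M.+1 * n + r - i).+1 by lia.
have E := mul_bin_diag (M.+1 * n + r - i).+1 r; rewrite /= in E.
rewrite factS; have -> : r.+1 * r`! * 'C((M.+1 * n + r - i).+1, r.+1) =
  r`! * (r.+1 * 'C((M.+1 * n + r - i).+1, r.+1)) by ring.
by rewrite -E (_ : (_ - i).+1 = M.+1 * n + (r.+1 - i)); [ring|lia].
Qed.

End BinomialExpansion.

Lemma Posz_sum (I : Type) (s : seq I) (F : I -> nat) :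
  (\sum_(i <- s) F i)%N%:Z = \sum_(i <- s) (F i)%:Z.
Proof. exact: (big_morph Posz PoszD). Qed.

Lemma sum_sign_bin_bin (j k : nat) :
  \sum_(a < j.+1) (-1) ^+ (j - a) * 'C(j, a)%:Z * 'C(a, k)%:Z = (j == k)%:Z.
Proof.
elim: j k => [|j IH] k.
  by rewrite big_ord1 subnn expr0 bin0 !mul1r bin0n eq_sym.
have S (F : nat -> int) :
    \sum_(a < j.+2) (-1) ^+ (j.+1 - a) * 'C(j.+1, a)%:Z * F a =
    \sum_(a < j.+1) (-1) ^+ (j - a) * 'C(j, a)%:Z * (F a.+1 - F a).
  pose g a := (-1) ^+ (j.+1 - a) * 'C(j, a)%:Z * F a.
  have gE : \sum_(a < j.+1) g a = g 0%N + \sum_(a < j.+1) g a.+1.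
    have := @big_ord_recl _ 0 +%R j.+1 (fun a => g a).
    by rewrite big_ord_recr /= {2}/g bin_small // mulr0 mul0r addr0.
  rewrite big_ord_recl /= !bin0.
  transitivity (\sum_(a < j.+1) (g a +
      (-1) ^+ (j - a) * 'C(j, a)%:Z * F a.+1)); last first.
    apply: eq_bigr => a _; rewrite /g subSn -1?ltnS // exprS; ring.
  rewrite big_split /= gE -addrA -big_split /= /g bin0; congr (_ + _).
  by apply: eq_bigr => a _; rewrite /bump /= add1n subSS binS PoszD; ring.
rewrite (S (fun a => 'C(a, k)%:Z)); case: k => [|k].
  by rewrite big1 // => a _; rewrite !bin0 subrr mulr0.
rewrite eqSS -IH; apply: eq_bigr => a _; rewrite binS PoszD; ring.
Qed.

Lemma dvdz_bin_coef (r N : nat) (q : nat -> int) (A : nat -> nat) :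
  (forall n, N%:Z * q n = \sum_(l < r.+1) (A l * 'C(n + r - l, r))%N%:Z) ->
  forall l, (l <= r)%N -> (N %| A l)%N.
Proof.
move=> qE l; elim/ltn_ind: l => l IH lr.
have lr1 : (l < r.+1)%N by [].
have := qE l; rewrite (bigD1 (Ordinal lr1)) //= addKn binn muln1 => E.
suff: (N%:Z %| (A l)%:Z)%Z by [].
have -> : (A l)%:Z = N%:Z * q l -
    \sum_(k < r.+1 | k != Ordinal lr1) (A k * 'C(l + r - k, r))%N%:Z.
  by rewrite E addrK.
apply: rpredB; first exact: dvdz_mulr.
apply: rpred_sum => k; rewrite -val_eqE /= => kl.
have kr : (k <= r)%N by rewrite -ltnS.
have [lk|lk] := ltnP l k.
  by rewrite bin_small ?muln0 ?dvdz0 //; lia.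
by apply: dvdn_mulr; apply: IH => //; rewrite ltn_neqAle kl.
Qed.

Lemma bin_mul_difference (r i j : nat) : (i <= r)%N ->
  exists c : nat -> nat, forall n : nat,
    \sum_(k < j.+1) (-1) ^+ (j - k) * 'C(j, k)%:Z * 'C(k.+1 * n + r - i, r)%:Z
      = \sum_(l < r.+1) (c l * 'C(n + r - l, r))%N%:Z.
Proof.
move=> /bin_mul_expansion[s /allP sA sE].
pose A l := count_mem (j, l) s.
set q := fun n : nat => \sum_(k < j.+1) (-1) ^+ (j - k) * 'C(j, k)%:Z *
  'C(k.+1 * n + r - i, r)%:Z.
have qE n : r`!%:Z * q n = \sum_(l < r.+1) (A l * 'C(n + r - l, r))%N%:Z.
  rewrite /q mulr_sumr.
  under eq_bigr => k _ do rewrite mulrCA -PoszM sE Posz_sum mulr_sumr.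
  rewrite exchange_big /=.
  have E t : t \in s ->
      \sum_(k < j.+1) (-1) ^+ (j - k) * 'C(j, k)%:Z * (pair_term r k n t)%:Z
      = \sum_(l < r.+1) ((t == (j, l : nat)) * 'C(n + r - l, r))%N%:Z.
    move=> /sA/and3P[tr _ _]; rewrite /pair_term.
    under eq_bigr => k _ do rewrite PoszM mulrA.
    rewrite -mulr_suml sum_sign_bin_bin.
    have tr1 : (t.2 < r.+1)%N by [].
    rewrite (bigD1 (Ordinal tr1)) //= big1 ?addr0; last first.
      move=> l; rewrite -val_eqE /= => lt; rewrite -pair_eqE /pair_eq /=.
      by rewrite (eq_sym t.2) (negPf lt) andbF.
    by rewrite -pair_eqE /pair_eq /= eqxx andbT PoszM eq_sym.
  rewrite big_seq (eq_bigr _ E) -big_seq exchange_big; apply: eq_bigr => l _ /=.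
  rewrite /A -sum1_count -Posz_sum -big_distrl; congr (Posz (_ * _)).
  by rewrite [RHS]big_mkcond; apply: eq_bigr => t _ /=; case: eqP.
have dv := dvdz_bin_coef _ _ _ _ qE.
exists (fun l => A l %/ r`!)%N => n; apply: (@mulfI _ r`!%:Z).
  by rewrite eqz_nat -lt0n fact_gt0.
rewrite -/(q n) qE mulr_sumr; apply: eq_bigr => l _.
by rewrite -PoszM mulnA (mulnC r`!) divnK // dv // -ltnS.
Qed.

Lemma dilate_dilate (R : realType) (d : nat) (P : set 'rV[R]_d) (m n : nat) :
  dilate m (dilate n P) = dilate (m * n) P.
Proof.
apply/seteqP; split => [x [_ [y Py <-] <-]|x [y Py <-]].
  by exists y => //; rewrite scalerA natrM.
by exists (n%:R *: y); [exists y|rewrite scalerA natrM].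
Qed.

Lemma polytope_dim_le (R : realType) (d : nat) (P : set 'rV[R]_d) :
  (polytope_dim P <= d)%N.
Proof. by apply/bigmax_leqP => k _; rewrite -ltnS. Qed.

Lemma fstar0 (R : realType) (d : nat) (G : porderZmodType)
  (phi : set 'rV[R]_d -> G) : fstar phi 0 = phi.
Proof.
apply/funext => P; rewrite /fstar big_ord1 /= expr0 mul1r mulr1z.
congr phi; apply/seteqP; split => [x [y Py <-]|x Px].
  by rewrite scale1r.
by exists x => //; rewrite scale1r.
Qed.

Lemma compatible_addr_ge0 (G : porderZmodType) (x y : G) :
  order_compatible G -> 0 <= x -> 0 <= y -> 0 <= x + y.
Proof.
move=> G_compat x0 y0; apply: (le_trans y0).
by have := G_compat _ _ y x0; rewrite add0r.
Qed.

Lemma compatible_sumrMn_ge0 (G : porderZmodType) (n : nat) (h : nat -> G)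
  (c : nat -> nat) : order_compatible G ->
  (forall i, (i < n)%N -> 0 <= h i) -> 0 <= \sum_(i < n) h i *+ c i.
Proof.
move=> G_compat h0; elim/big_ind: _ => // [x y|i _].
  exact: compatible_addr_ge0.
elim: (c i) => [|k IH]; first by rewrite mulr0n.
by rewrite mulrS; apply: compatible_addr_ge0 => //; apply: h0.
Qed.

Lemma fstar_hstar_vector (R : realType) (d : nat) (G : porderZmodType)
  (phi : set 'rV[R]_d -> G) (P : set 'rV[R]_d) (j : nat) (h : nat -> G) :
  hstar_vector phi P h ->
  exists c : nat -> nat -> nat, hstar_vector (fstar phi j) P
    (fun l => \sum_(i < (polytope_dim P).+1) h i *+ c i l).
Proof.
move=> [h0 h1]; set r := polytope_dim P.
have [|c cE] := @choice _ _ (fun i (c : nat -> nat) =>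
    ((r < i)%N \/ forall n : nat,
    \sum_(k < j.+1) (-1) ^+ (j - k) * 'C(j, k)%:Z * 'C(k.+1 * n + r - i, r)%:Z
      = \sum_(l < r.+1) (c l * 'C(n + r - l, r))%N%:Z)).
  move=> i; have [ri|ir] := ltnP r i; first by exists (fun=> 0%N); left.
  by have [c cE] := bin_mul_difference r i j ir; exists c; right.
exists (fun i l => if (l <= r)%N then c i l else 0%N); split.
  by move=> P0 l; rewrite big1 // => i _; rewrite h0 // mul0rn.
move=> P0; have [hE _] := h1 P0; rewrite -/r in hE *.
split=> [n|l rl]; last by rewrite big1 // => i _; rewrite leqNgt rl.
rewrite /fstar.
under eq_bigr => k _ do rewrite dilate_dilate hE mulrz_suml.
rewrite exchange_big /=.
under [RHS]eq_bigr => l _ do rewrite -sumrMnl.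
rewrite [RHS]exchange_big /=; apply: eq_bigr => i _.
have [|{}cE] := cE i; first by rewrite ltnNge -ltnS ltn_ord.
under eq_bigr => k _ do rewrite pmulrn -mulrzA mulrC.
rewrite -mulrz_sumr cE mulrz_sumr; apply: eq_bigr => l _.
by rewrite -ltnS ltn_ord -mulrnA.
Qed.

Theorem theorem7p3 (R : realType) (d : nat) (L : set 'rV[R]_d)
    (G : porderZmodType) (phi : set 'rV[R]_d -> G) :
  is_lattice L \/ is_subfield_subspace L ->
  order_compatible G ->
  lambda_valuation L phi ->
  combinatorially_positive L phi <->
  (forall i : nat, (i <= d)%N -> combinatorially_positive L (fstar phi i)).
Proof.
move=> _ G_compat _; split=> [pos j _ P LP|/(_ 0%N (leq0n d))]; last first.
  by rewrite fstar0.
have [h hP h0] := pos P LP; have [c cP] := fstar_hstar_vector _ _ _ _ _ j _ hP.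
eexists; first exact: cP.
move=> l _; apply: (compatible_sumrMn_ge0 _ _ _ (c^~ l)) => // i ir.
by apply: h0; apply: leq_trans (polytope_dim_le _ _ P); rewrite -ltnS.
Qed.
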